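(* Let $$\mathcal{X}_4=\Big\{(t_1,t_2,t_3,\theta)\in(\mathbb{C}^\ast)^4\colon \theta^4+(4t_1^{-2}+4t_2^{-2}+4t_3^{-2}-2)\theta^2+(1-4t_1^{-2})(1-4t_2^{-2})(1-4t_3^{-2})=0\Big\}.$$ Then the projection $(t_1,t_2,t_3,\theta)\mapsto(t_1,t_2,\theta)$ makes $\mathcal{X}_4$ a $2$-fold regular cover over $$\big\{(t_1,t_2,\theta)\in(\mathbb{C}^\ast)^3\colon \theta^2\ne 1-4t_1^{-2},\ \theta^2\neq 1-4t_2^{-2},\ \theta^2\ne(1-4t_1^{-2})(1-4t_2^{-2})\big\}.$$ By symmetry, the projections $(t_1,t_2,t_3,\theta)\mapsto(t_1,t_3,\theta)$ and $(t_1,t_2,t_3,\theta)\mapsto(t_2,t_3,\theta)$ also define $2$-fold regular covers (over the subsets of $(\mathbb{C}^\ast)^3$ defined by the corresponding conditions, with the subscripts $1,2$ replaced by $1,3$ and by $2,3$ respectively).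
   Context: $\mathbb{C}^\ast=\mathbb{C}\setminus\{0\}$. Regular cover means a regular (Galois) covering map in the topological sense. *)

(* Defs.v *)
From HB Require Import structures.
From mathcomp Require Import all_boot all_order all_algebra.
From mathcomp Require Import complex.
From mathcomp Require Import all_classical all_reals all_analysis.
Import Order.TTheory GRing.Theory Num.Theory.
Import numFieldNormedType.Exports.

Set Implicit Arguments.
Unset Strict Implicit.
Unset Printing Implicit Defensive.

Local Open Scope classical_set_scope.
Local Open Scope ring_scope.

(* [R[i]] itself carries no topology; packed as a [numClosedFieldType] it gets
   the metric topology of its norm, i.e. the usual topology of the plane. *)
Definition Cplx (R : realType) : numClosedFieldType := R[i].

Definition homeomorphism (X Y : topologicalType) (f : X -> Y) : Prop :=
  exists g : Y -> X,
    [/\ continuous f, continuous g, cancel f g & cancel g f].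

(* [f] restricts to a homeomorphism from the subspace [V] onto the subspace
   [U]. *)
Definition homeomorphism_on (X Y : topologicalType) (V : set X) (U : set Y)
    (f : X -> Y) : Prop :=
  exists g : Y -> X,
    [/\ {homo f : x / V x >-> U x} /\ {homo g : y / U y >-> V y},
        {within V, continuous f}, {within U, continuous g},
        (forall x, V x -> g (f x) = x) & (forall y, U y -> f (g y) = y)].

Definition evenly_covered (E B : topologicalType) (p : E -> B) (U : set B) :
    Prop :=
  exists (I : Type) (V : I -> set E),
    [/\ (forall i, open (V i)), trivIset setT V,
        p @^-1` U = \bigcup_i V i &
        (forall i, homeomorphism_on (V i) U p)].

Definition covering_map (E B : topologicalType) (p : E -> B) : Prop :=
  [/\ continuous p, (forall b, exists e, p e = b) &
      (forall b, exists U : set B, [/\ open U, U b & evenly_covered p U])].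

Definition deck_transformation (E B : topologicalType) (p : E -> B)
    (h : E -> E) : Prop :=
  homeomorphism h /\ (forall e, p (h e) = p e).

(* Regular (Galois, normal): the deck group is transitive on every fibre. *)
Definition regular_covering_map (E B : topologicalType) (p : E -> B) : Prop :=
  covering_map p /\
  (forall e e' : E, p e = p e' ->
     exists h : E -> E, deck_transformation p h /\ h e = e').

Definition fold_regular_covering_map (n : nat) (E B : topologicalType)
    (p : E -> B) : Prop :=
  regular_covering_map p /\ (forall b, (p @^-1` [set b] #= `I_n)%card).

(* [q] maps the subspace [E] into the subspace [B], and the induced map
   [E -> B] (which is unique) is an [n]-fold regular covering.  Here [E] and
   [B] are coerced to their [set_type]s, with the subspace topology. *)
Definition induces_fold_regular_cover (n : nat) (X Y : topologicalType)
    (E : set X) (B : set Y) (q : X -> Y) : Prop :=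
  exists p : E -> B,
    (forall e : E, set_val (p e) = q (set_val e)) /\
    fold_regular_covering_map n p.

Section Varieties.
Variable R : realType.
Local Notation C := (Cplx R).

Definition X4 : set (C * C * C * C) :=
  [set x | let: (t1, t2, t3, theta) := x in
    [/\ t1 != 0, t2 != 0, t3 != 0, theta != 0 &
     theta ^+ 4
     + (4 * t1 ^- 2 + 4 * t2 ^- 2 + 4 * t3 ^- 2 - 2) * theta ^+ 2
     + (1 - 4 * t1 ^- 2) * (1 - 4 * t2 ^- 2) * (1 - 4 * t3 ^- 2) = 0]].

Definition cover_base : set (C * C * C) :=
  [set y | let: (s, t, theta) := y in
    [/\ s != 0, t != 0 & theta != 0] /\
    [/\ theta ^+ 2 != 1 - 4 * s ^- 2,
        theta ^+ 2 != 1 - 4 * t ^- 2 &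
        theta ^+ 2 != (1 - 4 * s ^- 2) * (1 - 4 * t ^- 2)]].

Definition proj12 (x : C * C * C * C) : C * C * C :=
  let: (t1, t2, t3, theta) := x in (t1, t2, theta).
Definition proj13 (x : C * C * C * C) : C * C * C :=
  let: (t1, t2, t3, theta) := x in (t1, t3, theta).
Definition proj23 (x : C * C * C * C) : C * C * C :=
  let: (t1, t2, t3, theta) := x in (t2, t3, theta).

End Varieties.

(* Main.v *)
Require Import Defs.
From HB Require Import structures.
From mathcomp Require Import all_boot all_order all_algebra.
From mathcomp Require Import complex.
From mathcomp Require Import all_classical all_reals all_analysis.
From mathcomp Require Import ring.
Import Order.TTheory GRing.Theory Num.Theory.
Import numFieldNormedType.Exports.
Set Implicit Arguments.
Unset Strict Implicit.
Unset Printing Implicit Defensive.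
Local Open Scope classical_set_scope.
Local Open Scope ring_scope.

(** Put a_i = 4 / t_i^2 and u = theta^2.  The equation of X4 has degree one in
    each a_i; solved for a_3 it reads
      a_3 (u - (1 - a_1)(1 - a_2)) = - (u - (1 - a_1)) (u - (1 - a_2)).
    On X4 the factor u - (1 - a_1)(1 - a_2) cannot vanish: otherwise the right
    side would vanish too, and for u = (1 - a_1)(1 - a_2) it is - a_1 a_2 u.
    As a_3 is not zero either, the point (t_1, t_2, theta) lies in the base, and
    over the base the equation says t_3^2 = c for an explicit continuous
    function c without zeros (X4_coordinate_sqr, coordinate_sqr_continuous,
    coordinate_sqr_neq0).  So X4 is the pullback under c of the squaring map of
    the punctured plane.

    Such a pullback is always a 2-fold regular cover
    (square_root_pullback_fold_regular_cover).  Two opposite roots form each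
    fibre, and negating the root is the nontrivial deck transformation.  The
    two sheets over the open set |z0^2 - c| < |z0^2| are the parts where the
    root z satisfies |z0 - z| < |z0|, respectively |z0 + z| < |z0|: the product
    of |z0 - z| and |z0 + z| is less than |z0|^2 and their sum is at least
    2 |z0|, so exactly one of the two inequalities holds.  The other two
    projections reduce to the first because the equation is symmetric in t_1,
    t_2, t_3. *)

(** * A continuous square root near a nonzero point *)

(** The norm of z0^2 - z^2 is |z0 - z| |z0 + z|, so both factors cannot be at
    least |z0|. *)
Lemma sqr_near_root (C : numClosedFieldType) (z0 z : C) : z0 != 0 ->
  `|z0 ^+ 2 - z ^+ 2| < `|z0 ^+ 2| ->
  `|z0 - z| < `|z0| \/ `|z0 + z| < `|z0|.
Proof.
move=> z00 h.
have [|far] := real_ltP (normr_real (z0 - z)) (normr_real z0); first by left.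
have [|far'] := real_ltP (normr_real (z0 + z)) (normr_real z0); first by right.
suff : `|z0 ^+ 2| <= `|z0 ^+ 2 - z ^+ 2| by move/(lt_le_trans h); rewrite ltxx.
by rewrite normrX subr_sqr normrM expr2 ler_pM.
Qed.

(** The quantitative form of uniqueness of the root near z0: as z + w differs
    from 2 z0 by (z0 - z) + (z0 - w), it stays away from 0. *)
Lemma normD_near (C : numClosedFieldType) (z0 z w : C) :
  `|z0 - w| < `|z0| -> `|z0| - `|z0 - z| <= `|z + w|.
Proof.
move=> h.
have -> : z + w = (z0 *+ 2 - (z0 - w)) - (z0 - z) by ring.
apply: le_trans (lerB_dist _ _); rewrite lerD2r.
apply: le_trans (lerB_dist _ _); rewrite normrMn mulr2n.
by rewrite lerBrDr lerD2l ltW.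
Qed.

Lemma root_near_unique (C : numClosedFieldType) (z0 z w : C) :
  `|z0 - z| < `|z0| -> `|z0 - w| < `|z0| -> z ^+ 2 = w ^+ 2 -> z = w.
Proof.
move=> hz hw /eqP; rewrite -subr_eq0 subr_sqr mulf_eq0 subr_eq0.
case/orP=> [/eqP//|/eqP zw0].
have := normD_near z hw; rewrite zw0 normr0 subr_le0.
by move/(lt_le_trans hz); rewrite ltxx.
Qed.

(** A branch of the square root near z0.  It is total: where c has no root
    within |z0| of z0, it is just some root of c. *)
Definition sqrt_near (C : numClosedFieldType) (z0 c : C) : C :=
  if `|z0 - sqrtC c| < `|z0| then sqrtC c else - sqrtC c.

Lemma sqrt_nearK (C : numClosedFieldType) (z0 c : C) :
  sqrt_near z0 c ^+ 2 = c.
Proof. by rewrite /sqrt_near; case: ifP; rewrite ?sqrrN sqrtCK. Qed.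

Lemma sqrt_near_near (C : numClosedFieldType) (z0 c : C) : z0 != 0 ->
  `|z0 ^+ 2 - c| < `|z0 ^+ 2| -> `|z0 - sqrt_near z0 c| < `|z0|.
Proof.
move=> z00 hc; rewrite /sqrt_near; case: ifP => // /negP far.
have := @sqr_near_root _ z0 (sqrtC c) z00; rewrite sqrtCK => /(_ hc)[//|].
by rewrite opprK.
Qed.

(** For two roots z and w near z0, |z - w| = |z^2 - w^2| / |z + w|, and the
    denominator is at least |z0| - |z0 - z| by normD_near. *)
Lemma sqrt_near_continuous (C : numClosedFieldType) (z0 c : C) : z0 != 0 ->
  `|z0 ^+ 2 - c| < `|z0 ^+ 2| -> {for c, continuous (sqrt_near z0)}.
Proof.
move=> z00 hc; set z := sqrt_near z0 c.
have d0 : 0 < `|z0| - `|z0 - z| by rewrite subr_gt0 sqrt_near_near.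
have FF : Filter (nbhs c) := nbhs_filter c.
apply/(@cvgrPdist_lt _ _ _ _ FF) => e e0.
have nb1 : nbhs c (ball (z0 ^+ 2) `|z0 ^+ 2|).
  apply: open_nbhs_nbhs; split.
    by apply: ball_open; rewrite normr_gt0 expf_neq0.
  by rewrite -ball_normE.
have nb2 : nbhs c (ball c (e * (`|z0| - `|z0 - z|))).
  by apply: nbhsx_ballx; rewrite mulr_gt0.
apply: filterS2 nb1 nb2 => x; rewrite -ball_normE /= -/z => hx hcx.
set w := sqrt_near z0 x.
have hw : `|z0 - w| < `|z0| by exact: sqrt_near_near.
have le := normD_near z hw.
rewrite -(ltr_pM2r d0); apply: le_lt_trans hcx.
have -> : c - x = (z - w) * (z + w) by rewrite -subr_sqr !sqrt_nearK.
by rewrite normrM ler_wpM2l.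
Qed.

(** * Pullbacks of the squaring map *)

Lemma card_set2 (T : choiceType) (a b : T) :
  a != b -> ([set a; b] #= `I_2)%card.
Proof.
move=> ab; pose f n := if n == 0%N then a else b.
have -> : [set a; b] = f @` `I_2.
  apply/seteqP; split=> [x [->|->]|_ [[|[|n]] //= _ <-]].
  - by exists 0%N.
  - by exists 1%N.
  - by left.
  - by right.
apply: inj_card_eq => -[|[|m]] [|[|n]]; rewrite !inE //= /f /=.
- by move=> _ _ ab'; rewrite ab' eqxx in ab.
- by move=> _ _ ab'; rewrite ab' eqxx in ab.
Qed.

(** E is the pullback of the squaring map of the punctured plane along c: its
    points are the pairs of b in B and a square root r of c b, and its topology
    is the coarsest one making p and r continuous.  That last condition,
    srp_initial, is stated by its universal property, at a point so that it also
    applies to maps that are continuous on an open set only. *)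
Record square_root_pullback (C : numClosedFieldType) (E B : topologicalType)
    (p : E -> B) (r : E -> C) (c : B -> C) : Prop := {
  srp_p : continuous p;
  srp_r : continuous r;
  srp_c : continuous c;
  srp_c0 : forall b, c b != 0;
  srp_sqr : forall e, r e ^+ 2 = c (p e);
  srp_lift : forall b z, z ^+ 2 = c b -> exists e, p e = b /\ r e = z;
  srp_inj : forall e e', p e = p e' -> r e = r e' -> e = e';
  srp_initial : forall (T : topologicalType) (g : T -> E) t,
    {for t, continuous (p \o g)} -> {for t, continuous (r \o g)} ->
    {for t, continuous g}
}.

Lemma square_root_pullback_neqN (C : numClosedFieldType)
    (E B : topologicalType) (p : E -> B) (r : E -> C) (c : B -> C) (e : E) :
  square_root_pullback p r c -> r e != - r e.
Proof. by case=> _ _ _ c0 rp _ _ _; rewrite eq_sym eqNr -sqrf_eq0 rp. Qed.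

(** Over the part of B where |c b0 - c b| < |c b0|, the two roots z0 and - z0 of
    c b0 index the sheets, each sheet being the image of the section whose
    r-value is the branch sqrt_near of c. *)
Lemma square_root_pullback_evenly_covered (C : numClosedFieldType)
    (E B : topologicalType) (p : E -> B) (r : E -> C) (c : B -> C) (b0 : B) :
  square_root_pullback p r c ->
  exists U : set B, [/\ open U, U b0 & evenly_covered p U].
Proof.
move=> srp; have [pC rC cC c0 rp lift inj init] := srp.
pose z0 := sqrtC (c b0).
have z00 : z0 != 0 by rewrite sqrtC_eq0 c0.
pose U := c @^-1` ball (c b0) `|c b0|.
have oU : open U.
  apply: open_comp; first by move=> b _; exact: cC.
  by apply: ball_open; rewrite normr_gt0 c0.
pose zi (i : bool) := if i then z0 else - z0.
have ziE i : zi i ^+ 2 = c b0 by rewrite /zi; case: i; rewrite ?sqrrN sqrtCK.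
have zi0 i : zi i != 0 by rewrite /zi; case: i; rewrite ?oppr_eq0.
pose W i := r @^-1` ball (zi i) `|zi i|.
have oW i : open (W i).
  apply: open_comp; first by move=> e _; exact: rC.
  by apply: ball_open; rewrite normr_gt0.
have WE i e : W i e <-> `|zi i - r e| < `|zi i| by rewrite /W -ball_normE.
have UE i b : U b <-> `|zi i ^+ 2 - c b| < `|zi i ^+ 2|.
  by rewrite /U -ball_normE /= ziE.
exists U; split => //; first by apply: ballxx; rewrite normr_gt0.
exists bool, (fun i => p @^-1` U `&` W i); split.
- by move=> i; apply: openI => //; apply: open_comp => // e _; exact: pC.
- apply/trivIsetP => i j _ _ ij; rewrite -subset0 => e [[_ /WE we] [_ /WE we']].
  (* On both sheets, r e and - r e would be two roots near zi i. *)
  have h' : `|zi i - - r e| < `|zi i|.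
    have zji : zi j = - zi i.
      by move: ij; rewrite /zi; case: (i); case: (j); rewrite ?opprK.
    by move: we'; rewrite zji -opprD !normrN opprK.
  have /eqP := square_root_pullback_neqN e srp; apply.
  by apply: root_near_unique we h' _; rewrite sqrrN.
- apply/seteqP; split=> [e /= Ue|e [i _ []] //].
  have /(UE true) := Ue; rewrite -rp => /(sqr_near_root (zi0 true))[h|h].
    by exists true => //; split=> //; apply/WE.
  exists false => //; split => //; apply/WE.
  by rewrite /= -opprD !normrN.
- move=> i.
  have liftb b : exists e, p e = b /\ r e = sqrt_near (zi i) (c b).
    by apply: lift; rewrite sqrt_nearK.
  pose g b := projT1 (cid (liftb b)).
  have pg b : p (g b) = b by rewrite /g; case: cid => e [].
  have rg b : r (g b) = sqrt_near (zi i) (c b) by rewrite /g; case: cid => e [].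
  exists g; split.
  + split=> [e []//|b Ub]; split; first by rewrite /= pg.
    by apply/WE; rewrite rg sqrt_near_near //; apply/UE.
  + exact: continuous_subspaceT.
  + rewrite continuous_open_subspace // => b /[!inE] Ub; apply: init.
      have -> : p \o g = id by apply/funext => x /=.
      exact: cvg_id.
    have -> : r \o g = sqrt_near (zi i) \o c by apply/funext => x /=.
    apply: continuous_comp; first exact: cC.
    by apply: sqrt_near_continuous => //; apply/UE.
  + move=> e [Ue We]; apply: inj; first exact: pg.
    rewrite rg; apply: (@root_near_unique _ (zi i)).
    * by rewrite sqrt_near_near //; apply/UE.
    * by apply/WE.
    * by rewrite sqrt_nearK rp.
  + by move=> b _.
Qed.

Lemma square_root_pullback_involution (C : numClosedFieldType)
    (E B : topologicalType) (p : E -> B) (r : E -> C) (c : B -> C) :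
  square_root_pullback p r c ->
  exists h : E -> E, deck_transformation p h /\ forall e, r (h e) = - r e.
Proof.
case=> pC rC cC c0 rp lift inj init.
have lifth e : exists e', p e' = p e /\ r e' = - r e.
  by apply: lift; rewrite sqrrN rp.
pose h e := projT1 (cid (lifth e)).
have ph e : p (h e) = p e by rewrite /h; case: cid => e' [].
have rh e : r (h e) = - r e by rewrite /h; case: cid => e' [].
have hK : cancel h h by move=> e; apply: inj; rewrite ?ph // !rh opprK.
have hC : continuous h.
  move=> e; apply: init.
    have -> : p \o h = p by apply/funext => x /=.
    exact: pC.
  have -> : r \o h = -%R \o r by apply/funext => x /=.
  by apply: continuous_comp; [exact: rC | exact: opp_continuous].
by exists h; split => //; split => //; exists h.
Qed.

(** A fibre consists of a point and its image under the involution, since two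
    roots of the same number are equal or opposite; this gives both the
    transitivity of the deck group and the number of sheets. *)
Lemma square_root_pullback_fold_regular_cover (C : numClosedFieldType)
    (E B : topologicalType) (p : E -> B) (r : E -> C) (c : B -> C) :
  square_root_pullback p r c -> fold_regular_covering_map 2 p.
Proof.
move=> srp; have [h [dh rh]] := square_root_pullback_involution srp.
have ph e : p (h e) = p e by case: dh.
have [pC rC cC c0 rp lift inj init] := srp.
have fibre e e' : p e = p e' -> e' = e \/ e' = h e.
  move=> pe.
  have : (r e' == r e) || (r e' == - r e) by rewrite -eqf_sqr !rp pe.
  by case/orP => /eqP re; [left|right]; apply: inj; rewrite ?ph ?rh.
have surj b : exists e, p e = b.
  by have [e [<-]] := lift b (sqrtC (c b)) (sqrtCK _); exists e.
split; first split.
- by split=> // b; exact: square_root_pullback_evenly_covered srp.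
- move=> e e' /fibre[->|->]; last by exists h.
  by exists id; split=> //; split=> //; exists id; split=> // x; exact: cvg_id.
- move=> b; have [e <-] := surj b.
  have -> : p @^-1` [set p e] = [set e; h e].
    by apply/seteqP; split=> [e' /= /esym/fibre|e' [->|->]].
  apply: card_set2; apply/eqP => eh.
  by have := square_root_pullback_neqN e srp; rewrite -rh -eh eqxx.
Qed.

(** * Continuity in products and subspaces *)

Lemma continuous_comp_fst (U V W : topologicalType) (f : U -> V * W) :
  continuous f -> continuous (fun x => (f x).1).
Proof. by move=> fC x; apply: (continuous_comp (fC x)); exact: cvg_fst. Qed.

Lemma continuous_comp_snd (U V W : topologicalType) (f : U -> V * W) :
  continuous f -> continuous (fun x => (f x).2).
Proof. by move=> fC x; apply: (continuous_comp (fC x)); exact: cvg_snd. Qed.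

Lemma continuous_pair (U V W : topologicalType) (f : U -> V) (g : U -> W) :
  continuous f -> continuous g -> continuous (fun x => (f x, g x)).
Proof. by move=> fC gC x; exact: (cvg_pair (fC x) (gC x)). Qed.

Lemma continuous_set_type (X T : topologicalType) (A : set X) (g : T -> A) t :
  {for t, continuous (set_val \o g)} -> {for t, continuous g}.
Proof.
move=> gC U [/= _ [[W oW <-]] /= Wgt /filterS]; apply; apply: gC.
exact: open_nbhs_nbhs.
Qed.

(** * Pullbacks of the squaring map between subspaces *)

(** The maps (q, r) and m identify X with Y * C, so that A becomes the set of
    pairs (y, z) with y in B and z^2 = c y. *)
Lemma square_root_pullback_set_type (C : numClosedFieldType)
    (X Y : topologicalType) (A : set X) (B : set Y)
    (q : X -> Y) (r : X -> C) (m : Y * C -> X) (c : Y -> C) :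
  continuous q -> continuous r -> continuous m ->
  (forall x, m (q x, r x) = x) ->
  (forall y z, q (m (y, z)) = y) -> (forall y z, r (m (y, z)) = z) ->
  (forall y, B y -> {for y, continuous c}) -> (forall y, B y -> c y != 0) ->
  (forall x, A x <-> B (q x) /\ r x ^+ 2 = c (q x)) ->
  exists p : A -> B, (forall e, set_val (p e) = q (set_val e)) /\
    square_root_pullback p (r \o set_val) (c \o set_val).
Proof.
move=> qC rC mC mqr qm rm cC c0 AE.
have AP (e : A) : A (set_val e) by exact: set_valP.
have BP (b : B) : B (set_val b) by exact: set_valP.
have Bq (e : A) : B (q (set_val e)) by have /AE[] := AP e.
pose p (e : A) : B := SigSub (mem_set (Bq e)).
exists p; split=> //; split.
- move=> e; apply: continuous_set_type.
  apply: (@continuous_comp _ _ _ (set_val : A -> X) q); last exact: qC.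
  exact: initial_continuous.
- move=> e; apply: continuous_comp; last exact: rC.
  exact: initial_continuous.
- move=> b; apply: continuous_comp; last exact: cC.
  exact: initial_continuous.
- by move=> b; apply: c0.
- by move=> e; have /AE[] := AP e.
- move=> b z zb.
  have Am : A (m (set_val b, z)) by apply/AE; rewrite qm rm.
  exists (SigSub (mem_set Am) : A); split; last by rewrite /= rm.
  by apply: val_inj; rewrite /= qm.
- move=> e e' pe re; apply: val_inj; rewrite -[LHS]mqr -[RHS]mqr.
  by congr (m (_, _)) => //; exact: (congr1 set_val pe).
- move=> T g t pg rg; apply: continuous_set_type.
  have -> : set_val \o g =
      m \o (fun x => (set_val (p (g x)), r (set_val (g x)))).
    by apply/funext => x /=; rewrite mqr.
  apply: continuous_comp; last exact: mC.
  have qg : {for t, continuous (fun x => set_val (p (g x)))}.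
    apply: (@continuous_comp _ _ _ (p \o g) (set_val : B -> Y)) => //.
    exact: initial_continuous.
  exact: (cvg_pair qg rg).
Qed.

(** * The equation of X4 *)

(** The equation is of degree one in a3.  If the coefficient of a3 vanished,
    that is u = (1 - a1)(1 - a2), then so would (u - (1 - a1)) (u - (1 - a2)),
    which for this u is a1 a2 u. *)
Lemma ratio_equation_iff (F : fieldType) (a1 a2 a3 u : F) :
  a1 != 0 -> a2 != 0 -> u != 0 ->
  a3 != 0 /\ u ^+ 2 + (a1 + a2 + a3 - 2) * u
     + (1 - a1) * (1 - a2) * (1 - a3) = 0 <->
  [/\ u != 1 - a1, u != 1 - a2 & u != (1 - a1) * (1 - a2)] /\
  a3 * (u - (1 - a1) * (1 - a2)) = - ((u - (1 - a1)) * (u - (1 - a2))).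
Proof.
move=> a10 a20 u0.
have E : u ^+ 2 + (a1 + a2 + a3 - 2) * u + (1 - a1) * (1 - a2) * (1 - a3) =
  a3 * (u - (1 - a1) * (1 - a2)) + (u - (1 - a1)) * (u - (1 - a2)) by ring.
rewrite E; split=> [[a30 /eqP]|[[u1 u2 u12] a3E]].
  rewrite addr_eq0 => /eqP a3E.
  have u12 : u != (1 - a1) * (1 - a2).
    apply/eqP => uE; move/eqP: a3E; rewrite uE subrr mulr0 eq_sym oppr_eq0.
    have -> : ((1 - a1) * (1 - a2) - (1 - a1)) *
        ((1 - a1) * (1 - a2) - (1 - a2)) = a1 * a2 * ((1 - a1) * (1 - a2)).
      by ring.
    by rewrite -uE !mulf_eq0 (negPf a10) (negPf a20) (negPf u0).
  have : a3 * (u - (1 - a1) * (1 - a2)) != 0 by rewrite mulf_neq0 // subr_eq0.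
  by rewrite a3E oppr_eq0 mulf_eq0 !subr_eq0 negb_or => /andP[].
split; last by rewrite a3E addNr.
apply/eqP => a30; move/eqP: a3E.
by rewrite a30 mul0r eq_sym oppr_eq0 mulf_eq0 !subr_eq0 (negPf u1) (negPf u2).
Qed.

(** The value of z^2 that the equation of X4 forces at (s, t, z, theta). *)
Definition coordinate_sqr (R : realType) (y : Cplx R * Cplx R * Cplx R) :
    Cplx R :=
  let: (s, t, theta) := y in
  - 4 * (theta ^+ 2 - (1 - 4 * s ^- 2) * (1 - 4 * t ^- 2))
  / ((theta ^+ 2 - (1 - 4 * s ^- 2)) * (theta ^+ 2 - (1 - 4 * t ^- 2))).

Lemma coordinate_sqr_neq0 (R : realType) (y : Cplx R * Cplx R * Cplx R) :
  cover_base y -> coordinate_sqr y != 0.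
Proof.
case: y => [[s t] theta] [_ [u1 u2 u12]]; rewrite /coordinate_sqr.
have n4 : (4 : Cplx R) != 0 by rewrite pnatr_eq0.
by rewrite !mulf_neq0 ?invr_neq0 ?oppr_eq0 ?mulf_neq0 ?subr_eq0.
Qed.

Lemma inverse_ratio_iff (F : fieldType) (k w d n : F) : w != 0 -> n != 0 ->
  k / w * d = - n <-> w = - k * d / n.
Proof.
move=> w0 n0; split=> [kE|wE].
  by apply: (mulIf n0); rewrite divfK // -[n in LHS]opprK -kE; field.
have -> : n = - k * d / w by apply: (mulIf w0); rewrite divfK // mulrC wE divfK.
by field.
Qed.

(** In ratio_equation_iff take a_i = 4 / t_i^2, and solve for z^2 = 4 / a3 by
    inverse_ratio_iff.  In the converse direction z is nonzero because
    coordinate_sqr has no zero on the base. *)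
Lemma X4_coordinate_sqr (R : realType) (s t z theta : Cplx R) :
  X4 (s, t, z, theta) <->
  cover_base (s, t, theta) /\ z ^+ 2 = coordinate_sqr (s, t, theta).
Proof.
have n4 : (4 : Cplx R) != 0 by rewrite pnatr_eq0.
have sqrN0 (x : Cplx R) : x != 0 -> 4 * x ^- 2 != 0.
  by move=> x0; rewrite mulf_neq0 // invr_neq0 // expf_neq0.
split=> [[s0 t0 z0 th0 eq0]|[By zE]].
  have [] := (ratio_equation_iff (4 * z ^- 2)
      (sqrN0 _ s0) (sqrN0 _ t0) (expf_neq0 2 th0)).1.
    by split; [exact: sqrN0 | rewrite -eq0 -exprM].
  move=> [u1 u2 u12] a3E; split => //.
  apply/(inverse_ratio_iff 4 _ (expf_neq0 2 z0) _) => //.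
  by rewrite mulf_neq0 ?subr_eq0.
have z0 : z != 0 by rewrite -sqrf_eq0 zE coordinate_sqr_neq0.
have [[s0 t0 th0] [u1 u2 u12]] := By.
have [] := (ratio_equation_iff (4 * z ^- 2)
      (sqrN0 _ s0) (sqrN0 _ t0) (expf_neq0 2 th0)).2.
  split=> //; apply/(inverse_ratio_iff 4 _ (expf_neq0 2 z0) _) => //.
  by rewrite mulf_neq0 ?subr_eq0.
by move=> _ eq0; split => //; rewrite -eq0 -exprM.
Qed.

Lemma coordinate_sqr_continuous (R : realType) (y : Cplx R * Cplx R * Cplx R) :
  cover_base y -> {for y, continuous (@coordinate_sqr R)}.
Proof.
case: y => [[s t] theta] [[s0 t0 th0] [u1 u2 u12]].
have -> : @coordinate_sqr R = fun y =>
  - 4 * (y.2 ^+ 2 - (1 - 4 * y.1.1 ^- 2) * (1 - 4 * y.1.2 ^- 2))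
  / ((y.2 ^+ 2 - (1 - 4 * y.1.1 ^- 2)) * (y.2 ^+ 2 - (1 - 4 * y.1.2 ^- 2))).
  by apply/funext => -[[]].
pose F := nbhs (s, t, theta).
have FF : Filter F := nbhs_filter _.
have idC : continuous (@id (Cplx R * Cplx R * Cplx R)).
  by move=> x; exact: cvg_id.
have cF (k : Cplx R) : (fun=> k) @ F --> k by exact: cvg_cst.
have sF : (fun y => y.1.1 : Cplx R) @ F --> s.
  exact: (continuous_comp_fst (continuous_comp_fst idC) (x := (s, t, theta))).
have tF : (fun y => y.1.2 : Cplx R) @ F --> t.
  exact: (continuous_comp_snd (continuous_comp_fst idC) (x := (s, t, theta))).
have uF : (fun y => y.2 ^+ 2 : Cplx R) @ F --> theta ^+ 2.
  have thF : (fun y => y.2 : Cplx R) @ F --> theta.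
    exact: (continuous_comp_snd idC (x := (s, t, theta))).
  exact: (cvgM thF thF).
have b (f : Cplx R * Cplx R * Cplx R -> Cplx R) x : x != 0 ->
    f @ F --> x -> (fun y => 1 - 4 * f y ^- 2) @ F --> 1 - 4 * x ^- 2.
  move=> x0 fF; apply: (cvgB (cF 1)); apply: (cvgM (cF 4)).
  by apply: cvgV; [rewrite expf_neq0 | exact: (cvgM fF fF)].
have sB := b _ _ s0 sF; have tB := b _ _ t0 tF.
apply: (cvgM (cvgM (cF (- 4)) (cvgB uF (cvgM sB tB)))).
apply: cvgV; first by rewrite mulf_neq0 ?subr_eq0.
exact: (cvgM (cvgB uF sB) (cvgB uF tB)).
Qed.

(** * The three projections *)

Lemma X4_swap23 (R : realType) (t1 t2 t3 theta : Cplx R) :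
  X4 (t1, t3, t2, theta) <-> X4 (t1, t2, t3, theta).
Proof.
suff H (s t z : Cplx R) : X4 (s, t, z, theta) -> X4 (s, z, t, theta).
  by split; apply: H.
by case=> s0 t0 z0 th0 eq0; split => //; rewrite -[RHS]eq0; ring.
Qed.

Lemma X4_swap12 (R : realType) (t1 t2 t3 theta : Cplx R) :
  X4 (t2, t1, t3, theta) <-> X4 (t1, t2, t3, theta).
Proof.
suff H (s t z : Cplx R) : X4 (s, t, z, theta) -> X4 (t, s, z, theta).
  by split; apply: H.
by case=> s0 t0 z0 th0 eq0; split => //; rewrite -[RHS]eq0; ring.
Qed.

(** The hypothesis on m says that, up to the symmetry of X4, m inserts z as the
    third coordinate. *)
Lemma induces_cover_X4 (R : realType) (q : Cplx R * Cplx R * Cplx R * Cplx R ->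
    Cplx R * Cplx R * Cplx R)
    (r : Cplx R * Cplx R * Cplx R * Cplx R -> Cplx R)
    (m : Cplx R * Cplx R * Cplx R * Cplx R ->
      Cplx R * Cplx R * Cplx R * Cplx R) :
  continuous q -> continuous r -> continuous m ->
  (forall x, m (q x, r x) = x) ->
  (forall y z, q (m (y, z)) = y) -> (forall y z, r (m (y, z)) = z) ->
  (forall s t theta z, X4 (m (s, t, theta, z)) <-> X4 (s, t, z, theta)) ->
  induces_fold_regular_cover 2 (@X4 R) (@cover_base R) q.
Proof.
move=> qC rC mC mqr qm rm X4m.
have X4E x : X4 x <-> cover_base (q x) /\ r x ^+ 2 = coordinate_sqr (q x).
  rewrite -[in X4 _](mqr x); case: (q x) => [[s t] theta].
  by rewrite X4m X4_coordinate_sqr.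
have [p [pq srp]] := square_root_pullback_set_type qC rC mC mqr qm rm
  (@coordinate_sqr_continuous R) (@coordinate_sqr_neq0 R) X4E.
by exists p; split=> //; exact: square_root_pullback_fold_regular_cover srp.
Qed.

Theorem mainTheorem3 (R : realType) :
  induces_fold_regular_cover 2 (@X4 R) (@cover_base R) (@proj12 R) /\
  induces_fold_regular_cover 2 (@X4 R) (@cover_base R) (@proj13 R) /\
  induces_fold_regular_cover 2 (@X4 R) (@cover_base R) (@proj23 R).
Proof.
pose C := Cplx R.
have idC : continuous (@id (C * C * C * C)) by move=> x; exact: cvg_id.
have c1 := continuous_comp_fst (continuous_comp_fst (continuous_comp_fst idC)).
have c2 := continuous_comp_snd (continuous_comp_fst (continuous_comp_fst idC)).
have c3 := continuous_comp_snd (continuous_comp_fst idC).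
have c4 := continuous_comp_snd idC.
split; [|split].
- apply: (@induces_cover_X4 _ _ (fun x => x.1.2)
    (fun x => (x.1.1.1, x.1.1.2, x.2, x.1.2))).
  + have -> : @proj12 R = fun x => (x.1.1.1, x.1.1.2, x.2).
      by apply/funext => -[[[]]].
    exact: continuous_pair (continuous_pair c1 c2) c4.
  + exact: c3.
  + exact: continuous_pair (continuous_pair (continuous_pair c1 c2) c4) c3.
  + by move=> [[[]]].
  + by move=> [[]].
  + by [].
  + by [].
- apply: (@induces_cover_X4 _ _ (fun x => x.1.1.2)
    (fun x => (x.1.1.1, x.2, x.1.1.2, x.1.2))).
  + have -> : @proj13 R = fun x => (x.1.1.1, x.1.2, x.2).
      by apply/funext => -[[[]]].
    exact: continuous_pair (continuous_pair c1 c3) c4.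
  + exact: c2.
  + exact: continuous_pair (continuous_pair (continuous_pair c1 c4) c2) c3.
  + by move=> [[[]]].
  + by move=> [[]].
  + by [].
  + by move=> s t theta z; exact: X4_swap23.
- apply: (@induces_cover_X4 _ _ (fun x => x.1.1.1)
    (fun x => (x.2, x.1.1.1, x.1.1.2, x.1.2))).
  + have -> : @proj23 R = fun x => (x.1.1.2, x.1.2, x.2).
      by apply/funext => -[[[]]].
    exact: continuous_pair (continuous_pair c2 c3) c4.
  + exact: c1.
  + exact: continuous_pair (continuous_pair (continuous_pair c4 c1) c2) c3.
  + by move=> [[[]]].
  + by move=> [[]].
  + by [].
  + by move=> s t theta z; rewrite X4_swap12 X4_swap23.
Qed.
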